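(* Let $I\subset R=\mathbb{K}[x_1,\ldots,x_n]$ be a monomial ideal minimally generated by monomials $f_1,\ldots,f_m$ ($m\ge 2$) such that for each $k=2,\ldots,m$ the colon ideal $(f_1,\ldots,f_{k-1}):f_k$ is generated by a regular sequence $\alpha_{k,1},\ldots,\alpha_{k,r_k}$ of monomials with $\deg(\alpha_{k,i})=a_{k,i}$ for $i=1,\ldots,r_k$. Let $d_k=\deg(f_k)$ for $k=1,\ldots,m$. Then: (1) $HS(I,t)=\frac{1}{(1-t)^n}\Big[t^{d_1}+\sum_{k=2}^m(1-t^{a_{k,1}})\cdots(1-t^{a_{k,r_k}})\,t^{d_k}\Big]$; (2) $\mathrm{reg}(I)\le \max\{d_k+a_{k,1}+\cdots+a_{k,r_k}-r_k : 2\le k\le m\}$; (3) $\mathrm{pdim}(I)\le \max\{r_2,\ldots,r_m\}$.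
   Context: $\mathbb{K}$ is a field and $R=\mathbb{K}[x_1,\ldots,x_n]$ is the standard graded polynomial ring. For a finitely generated graded $R$-module $M$, $\beta_{i,j}(M)=\dim_{\mathbb{K}}\mathrm{Tor}_i^R(M,\mathbb{K})_j$, $\mathrm{reg}(M)=\max\{j-i:\beta_{i,j}(M)\neq 0\}$, $\mathrm{pdim}(M)=\max\{i:\beta_{i,j}(M)\ne 0\text{ for some }j\}$, and $HS(M,t)=\sum_{i\in\mathbb{Z}}\dim_{\mathbb{K}}(M_i)t^i$. A sequence of (non-constant) monomials is regular on $R$ if and only if the monomials have pairwise disjoint supports, where the support of a monomial is the set of variables dividing it. *)

(* Defs.v *)
From HB Require Import structures.
From mathcomp Require Export all_boot all_order all_algebra.
From mathcomp Require Export mpoly.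

Set Implicit Arguments.
Unset Strict Implicit.
Unset Printing Implicit Defensive.

Import Order.TTheory GRing.Theory Num.Theory.
Local Open Scope ring_scope.

Section Ideals.
Variables (K : fieldType) (n : nat).
Local Notation R := {mpoly K[n]}.

(* Ideals are predicates on R. [ideal_gen g P] is the ideal generated by the
   members [g i], [P i], of the finite family [g]. *)
Definition ideal_gen (T : finType) (g : T -> R) (P : pred T) : R -> Prop :=
  fun p => exists c : T -> R, p = \sum_(i | P i) c i * g i.

Definition minimal_generators (T : finType) (g : T -> R) : Prop :=
  forall S : {set T}, S \proper [set: T] ->
    ~ (forall p, ideal_gen g (mem S) p <-> ideal_gen g xpredT p).

Definition colon (I : R -> Prop) (q : R) : R -> Prop := fun p => I (p * q).

(* Each g_i is a nonzerodivisor on R / (g_0, ..., g_(i-1)), and the quotient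
   R / (g_0, ..., g_(r-1)) is nonzero. *)
Definition regular_sequence (r : nat) (g : 'I_r -> R) : Prop :=
  (forall (i : 'I_r) (p : R),
      ideal_gen g [pred j : 'I_r | j < i]%N (g i * p) ->
      ideal_gen g [pred j : 'I_r | j < i]%N p)
  /\ ~ ideal_gen g xpredT 1.

(* R_j, which is zero in negative degrees *)
Definition homog_elt (j : int) (p : R) : Prop :=
  match j with
  | Posz d => p \is d.-homog
  | Negz _ => p = 0
  end.

Definition has_dim (V : R -> Prop) (d : nat) : Prop :=
  exists b : 'I_d -> R,
    (forall c : 'I_d -> K, \sum_i c i *: b i = 0 -> forall i, c i = 0)
    /\ (forall p, V p <-> exists c : 'I_d -> K, p = \sum_i c i *: b i).

(* H j is the coefficient of t^j in HS(I, t). *)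
Definition hilbert_series (I : R -> Prop) (H : int -> nat) : Prop :=
  forall j, has_dim (fun p => I p /\ homog_elt j p) (H j).

(* A graded free resolution  ... -> F_1 -> F_0 -> I -> 0  of the homogeneous
   ideal I by free modules of finite rank.  F_i is 'rV[R]_(rk i), its s-th
   basis vector having degree [dg s]; matrices act on the right of row
   vectors, and all maps preserve degrees. *)
Record graded_free_resolution (I : R -> Prop) := GradedFreeResolution {
  rk : nat -> nat;
  dg : forall i, 'I_(rk i) -> int;
  aug : 'cV[R]_(rk 0);
  dif : forall i, 'M[R]_(rk i.+1, rk i);
  aug_homog : forall s, homog_elt (dg s) (aug s 0);
  dif_homog : forall i s t, homog_elt (dg s - dg t) (dif i s t);
  aug_image : forall p, I p <-> exists v : 'rV_(rk 0), v *m aug = p%:M;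
  aug_exact : forall v : 'rV_(rk 0),
    v *m aug = 0 <-> exists w : 'rV_(rk 1), v = w *m dif 0;
  dif_exact : forall i (v : 'rV_(rk i.+1)),
    v *m dif i = 0 <-> exists w : 'rV_(rk i.+2), v = w *m dif i.+1
}.

Section Tor.
Variables (I : R -> Prop) (F : graded_free_resolution I).

(* The complex F (x)_R K, where K = R / (x_1, ..., x_n): its i-th term is
   'rV[K]_(rk F i) and its differentials are the constant terms of those
   of F. *)
Definition tor_dif (i : nat) : 'M[K]_(rk F i.+1, rk F i) :=
  map_mx (mcoeff 0%MM) (dif F i).

(* Subspaces are row spaces; [tor_piece i j] is (F_i (x) K)_j. *)
Definition tor_piece (i : nat) (j : int) : 'M[K]_(rk F i) :=
  diag_mx (\row_s (dg s == j)%:R).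

Definition tor_ker (i : nat) : 'M[K]_(rk F i) :=
  match i with
  | 0 => 1%:M
  | i'.+1 => kermx (tor_dif i')
  end.

Definition tor_cycles (i : nat) (j : int) : 'M[K]_(rk F i) :=
  (tor_piece i j :&: tor_ker i)%MS.

Definition tor_boundaries (i : nat) (j : int) : 'M[K]_(rk F i.+1, rk F i) :=
  tor_piece i.+1 j *m tor_dif i.

(* dim_K Tor_i(I, K)_j, computed from F as the dimension of cycles modulo
   boundaries *)
Definition tor_dim (i : nat) (j : int) : nat :=
  (\rank (tor_cycles i j) - \rank (tor_boundaries i j))%N.

End Tor.

(* beta i j = dim_K Tor_i(I, K)_j.  Resolutions exist, and Tor does not depend
   on the one which is used. *)
Definition betti_numbers (I : R -> Prop) (beta : nat -> int -> nat) : Prop :=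
  inhabited (graded_free_resolution I)
  /\ forall (F : graded_free_resolution I) i j, tor_dim F i j = beta i j.

Definition is_reg (I : R -> Prop) (rho : int) : Prop :=
  exists beta, [/\ betti_numbers I beta,
    exists i j, beta i j <> 0%N /\ rho = j - i%:Z
    & forall i j, beta i j <> 0%N -> j - i%:Z <= rho].

Definition is_pdim (I : R -> Prop) (p : nat) : Prop :=
  exists beta, [/\ betti_numbers I beta,
    exists j, beta p j <> 0%N
    & forall i j, beta i j <> 0%N -> (i <= p)%N].

End Ideals.

(* Formal power series over int, as sequences of coefficients. *)
Definition series_mul (a b : nat -> int) : nat -> int :=
  fun k => \sum_(i < k.+1) a i * b (k - i)%N.

(* 1 / (1 - t)^n, with 1 / (1 - t) = 1 + t + t^2 + ... *)
Definition inv_one_sub_t_pow (n : nat) : nat -> int :=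
  iter n (series_mul (fun=> 1)) (fun k => (k == 0%N)%:R).

Definition series_of_poly (p : {poly int}) : nat -> int := fun k => p`_k.

(* A power series as a Laurent series. *)
Definition laurent_coef (a : nat -> int) (j : int) : int :=
  match j with
  | Posz k => a k
  | Negz _ => 0
  end.

(* Main.v *)
Require Import Defs.
From Stdlib Require Import ClassicalEpsilon.
From mathcomp Require Import zify.

Set Implicit Arguments.
Unset Strict Implicit.
Unset Printing Implicit Defensive.

Import Order.TTheory GRing.Theory Num.Theory.
Local Open Scope ring_scope.

(** Adding one generator [q] to an ideal [J] gives the exact sequence of graded
    modules

      0 -> R/(J : q) (- deg q) -> R/J -> R/(J + (q)) -> 0,

    whose first map is multiplication by [q].  Both the resolutions and the
    Hilbert series of [R/I] are computed by walking along the generators with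
    this sequence.

    Resolutions.  The multiplication map lifts to a chain map from a resolution
    [G] of [R/(J : q)] to a resolution [F] of [R/J] ([comparison]), and its
    mapping cone resolves [R/(J + (q))] ([cone]).  In position [i] the cone has
    the basis elements of [F] and, with degrees raised by [deg q], those of [G]
    in position [i - 1] ([resolved_within_cone]).  If [q] is the next member of
    a regular sequence then [J : q] is [J], so that iterating cones resolves the
    complete intersection generated by [r] elements of degrees [a_1, ..., a_r]:
    this is the Koszul complex, whose basis elements in position [i] satisfy
    [i <= r] and [degree - i <= (a_1 - 1) + ... + (a_r - 1)]
    ([resolved_within_koszul]).  Iterating cones over [f_1, ..., f_m], with
    these Koszul complexes as resolutions of the colon ideals, resolves [R/I]
    ([resolved_within_iter]); removing the copy of [R] in position 0 resolves
    [I] by modules whose basis elements satisfy the bounds claimed for the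
    regularity and the projective dimension.  The generator [f_1] contributes
    only its degree [d_1], which the term [k = 2] of the first bound dominates:
    a generator [alpha] of [(f_1) : f_2] makes [alpha f_2] a multiple of [f_1],
    and a proper one since [f_2] does not divide [f_1], so that
    [d_1 <= d_2 + deg alpha - 1], and the other generators of [(f_1) : f_2] have
    positive degree.

    Betti numbers.  They may be computed from this particular resolution,
    because two resolutions of [I] admit comparison maps in both directions
    whose composites are homotopic to the identity ([null_homotopy]), and
    homotopies disappear in homology after tensoring with [K]
    ([tor_dim_unique]).  A Betti number is nonzero only where the resolution has
    a basis element ([tor_dim_neq0]), and some Betti number is nonzero by
    Nakayama's lemma ([tor0_neq0]), so that the regularity and the projective
    dimension exist.

    Hilbert series.  The monomials in [I] of degree [j] are a basis of [I_j]
    ([has_dim_monomials]).  The exact sequence above says that the monomials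
    outside [J] divisible by [q] are the products of [q] with the monomials
    outside [J : q] ([counted_by_remove]).  Hence numerators of Hilbert series
    over [(1-t)^n] satisfy [Q(J + (q)) = Q(J) - t^(deg q) Q(J : q)], and the
    formula follows by the same two iterations. *)

(** * Homogeneous polynomials and matrices *)

Section Homogeneity.
Variables (K : fieldType) (n : nat).
Local Notation R := {mpoly K[n]}.
Implicit Types (i j : int) (p q : R).

Lemma homog_eltP j p :
  homog_elt j p <-> forall m, p@_m != 0 -> (mdeg m)%:Z = j.
Proof.
case: j => d /=; split.
- by move=> /dhomogP h m; rewrite -mcoeff_msupp => /h ->.
- by move=> h; apply/dhomogP => m; rewrite mcoeff_msupp => /h [].
- by move=> -> m; rewrite mcoeff0 eqxx.
- move=> h; apply/mpolyP => m; rewrite mcoeff0; apply/eqP.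
  by apply: contraT => /h.
Qed.

Lemma homog_elt0 j : homog_elt j (0 : R).
Proof. by apply/homog_eltP => m; rewrite mcoeff0 eqxx. Qed.

Lemma homog_eltD j p q :
  homog_elt j p -> homog_elt j q -> homog_elt j (p + q).
Proof.
move=> /homog_eltP hp /homog_eltP hq; apply/homog_eltP => m.
rewrite mcoeffD; have [->|/hp //] := eqVneq p@_m 0.
by rewrite add0r => /hq.
Qed.

Lemma homog_eltN j p : homog_elt j p -> homog_elt j (- p).
Proof.
move=> /homog_eltP hp; apply/homog_eltP => m.
by rewrite mcoeffN oppr_eq0 => /hp.
Qed.

Lemma mcoeffM_neq0 p q m : (p * q)@_m != 0 ->
  exists k l, [/\ m = (k + l)%MM, p@_k != 0 & q@_l != 0].
Proof.
rewrite -mcoeff_msupp => /msuppM_le /allpairsP[[k l] /= [hk hl ->]].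
by exists k, l; rewrite -!mcoeff_msupp.
Qed.

Lemma homog_eltM i j p q :
  homog_elt i p -> homog_elt j q -> homog_elt (i + j) (p * q).
Proof.
move=> /homog_eltP hp /homog_eltP hq; apply/homog_eltP => m.
by case/mcoeffM_neq0=> k [l [-> /hp <- /hq <-]]; rewrite mdegD PoszD.
Qed.

Lemma homog_eltX (m : 'X_{1..n}) : homog_elt (mdeg m)%:Z ('X_[m] : R).
Proof. by rewrite /= dhomogX. Qed.

Definition homog_part j p : R :=
  \sum_(m <- msupp p | (mdeg m)%:Z == j) p@_m *: 'X_[m].

Lemma mcoeff_homog_part j p m :
  (homog_part j p)@_m = if (mdeg m)%:Z == j then p@_m else 0.
Proof.
rewrite raddf_sum /= (eq_bigr (fun k => p@_k * (k == m)%:R)); last first.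
  by move=> k _; rewrite mcoeffZ mcoeffX.
have [mp|mp] := boolP (m \in msupp p).
  rewrite -big_filter; case: ifP => hm.
    rewrite (bigD1_seq m) ?filter_uniq ?msupp_uniq ?mem_filter ?hm ?mp //=.
    rewrite eqxx mulr1 big1 ?addr0 // => k /negPf->; exact: mulr0.
  rewrite big_seq big1 // => k; rewrite mem_filter => /andP[hk _].
  by case: eqP => [km|]; [move: hk; rewrite km hm | rewrite mulr0].
rewrite (memN_msupp_eq0 mp) if_same big_seq_cond big1 // => k /andP[kp _].
by case: eqP => [km|]; [rewrite km (negPf mp) in kp | rewrite mulr0].
Qed.

Lemma homog_partP j p : homog_elt j (homog_part j p).
Proof.
apply/homog_eltP => m; rewrite mcoeff_homog_part.
by case: ifP => [/eqP-> //|_]; rewrite eqxx.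
Qed.

Lemma homog_part_id j p : homog_elt j p -> homog_part j p = p.
Proof.
move=> /homog_eltP hp; apply/mpolyP => m; rewrite mcoeff_homog_part.
case: eqP => // hm; apply/esym/eqP.
by apply: contraT => /hp.
Qed.

Lemma homog_part_sum (T : finType) j (F : T -> R) :
  homog_part j (\sum_i F i) = \sum_i homog_part j (F i).
Proof.
apply/mpolyP => m; rewrite mcoeff_homog_part !(raddf_sum (mcoeff m)) /=.
case: ifP => h; last by rewrite big1 // => i _; rewrite mcoeff_homog_part h.
by apply: eq_bigr => i _; rewrite mcoeff_homog_part h.
Qed.

Lemma homog_partM i j p q :
  homog_elt j q -> homog_part (i + j) (p * q) = homog_part i p * q.
Proof.
move=> /homog_eltP hq; apply/mpolyP => m; rewrite mcoeff_homog_part.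
have -> : (if (mdeg m)%:Z == i + j then (p * q)@_m else 0)
        = (if (mdeg m)%:Z == i + j then 1 else 0) * (p * q)@_m.
  by case: ifP; rewrite ?mul1r ?mul0r.
rewrite !mcoeffM mulr_sumr; apply: eq_bigr => -[k l] /= /eqP.
move: (bmnm k) (bmnm l) => {}k {}l ->; rewrite mcoeff_homog_part.
have [->|/hq <-] := eqVneq q@_l 0; first by rewrite !mulr0.
rewrite mdegD PoszD (inj_eq (addIr _)).
by case: ifP; rewrite ?mul1r ?mul0r.
Qed.

(** A matrix of a degree-preserving map between graded free modules whose
    bases have degrees [e] and [e']. *)
Definition homog_mx (a b : nat) (e : 'I_a -> int) (e' : 'I_b -> int)
    (A : 'M[R]_(a, b)) := forall s t, homog_elt (e s - e' t) (A s t).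

Lemma homog_mx0 (a b : nat) (e : 'I_a -> int) (e' : 'I_b -> int) :
  homog_mx e e' (0 : 'M_(a, b)).
Proof. by move=> s t; rewrite mxE; apply: homog_elt0. Qed.

Lemma homog_mxD (a b : nat) (e : 'I_a -> int) (e' : 'I_b -> int) A B :
  homog_mx e e' A -> homog_mx e e' B -> homog_mx e e' (A + B).
Proof. by move=> hA hB s t; rewrite mxE; apply: homog_eltD. Qed.

Lemma homog_mxN (a b : nat) (e : 'I_a -> int) (e' : 'I_b -> int) A :
  homog_mx e e' A -> homog_mx e e' (- A).
Proof. by move=> hA s t; rewrite mxE; apply: homog_eltN. Qed.

Lemma homog_mxM (a b c : nat) (e : 'I_a -> int) (e' : 'I_b -> int)
    (e'' : 'I_c -> int) A B :
  homog_mx e e' A -> homog_mx e' e'' B -> homog_mx e e'' (A *m B).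
Proof.
move=> hA hB s t; rewrite mxE; apply: big_ind; first exact: homog_elt0.
  by move=> x y; apply: homog_eltD.
move=> u _; have -> : e s - e'' t = (e s - e' u) + (e' u - e'' t).
  by rewrite addrA subrK.
exact: homog_eltM.
Qed.

(** Taking homogeneous parts of the coefficients turns any factorization
    through a homogeneous matrix into a homogeneous one. *)
Lemma homog_mx_factor (a b c : nat) (e : 'I_a -> int) (e' : 'I_b -> int)
    (e'' : 'I_c -> int) (A : 'M_(a, c)) (B : 'M_(b, c)) :
  homog_mx e e'' A -> homog_mx e' e'' B ->
  (forall s, exists w, row s A = w *m B) ->
  exists2 C, homog_mx e e' C & A = C *m B.
Proof.
move=> hA hB /fin_all_exists[w hw].
exists (\matrix_(s, u) homog_part (e s - e' u) (w s 0 u)).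
  by move=> s u; rewrite mxE; apply: homog_partP.
apply/matrixP => s t; rewrite -(homog_part_id (hA s t)).
have := congr1 (fun M : 'rV_c => M 0 t) (hw s); rewrite !mxE => ->.
rewrite homog_part_sum; apply: eq_bigr => u _; rewrite mxE.
have -> : e s - e'' t = (e s - e' u) + (e' u - e'' t).
  by rewrite addrA subrK.
exact: homog_partM.
Qed.

End Homogeneity.

(** * Resolutions and chain maps *)

Lemma dependent_choice_nat (T : nat -> Type) (P : forall i, T i -> Prop)
    (E : forall i, T i -> T i.+1 -> Prop) (x0 : T 0%N) :
  P 0%N x0 -> (forall i x, P i x -> exists2 y, P i.+1 y & E i x y) ->
  exists s : forall i, T i,
    [/\ s 0%N = x0, forall i, P i (s i) & forall i, E i (s i) (s i.+1)].
Proof.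
move=> P0 step.
have step' i (x : {x | P i x}) : {y : {y | P i.+1 y} | E i (sval x) (sval y)}.
  apply: constructive_indefinite_description.
  by case: x => x Px /=; have [y Py Exy] := step i x Px; exists (exist _ y Py).
pose s := fix s i : {x | P i x} :=
  if i is i'.+1 then sval (step' i' (s i')) else exist _ x0 P0.
exists (fun i => sval (s i)); split=> // i; first exact: (svalP (s i)).
exact: (svalP (step' i (s i))).
Qed.

Section Resolutions.
Variables (K : fieldType) (n : nat).
Local Notation R := {mpoly K[n]}.
Implicit Types I J : R -> Prop.

(** Prepending the augmentation to a resolution of [I] gives the resolution of
    the cyclic module [R / I]; its terms and maps are indexed uniformly, with
    [R] in position 0. *)
Definition crk I (F : graded_free_resolution I) (i : nat) : nat :=
  if i is i'.+1 then rk F i' else 1.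

Definition cdg I (F : graded_free_resolution I) (i : nat) :
    'I_(crk F i) -> int :=
  match i with 0%N => fun=> 0 | i'.+1 => @dg _ _ _ F i' end.

Definition cdif I (F : graded_free_resolution I) (i : nat) :
    'M[R]_(crk F i.+1, crk F i) :=
  match i with 0%N => aug F | i'.+1 => dif F i' end.

Section Basics.
Variables (I : R -> Prop) (F : graded_free_resolution I).

Lemma cdif_homog i : homog_mx (@cdg I F i.+1) (@cdg I F i) (cdif F i).
Proof.
case: i => [|i] s t /=; last exact: dif_homog.
by rewrite subr0 ord1; apply: aug_homog.
Qed.

Lemma cdif_exact i (v : 'rV_(crk F i.+1)) :
  v *m cdif F i = 0 <-> exists w, v = w *m cdif F i.+1.
Proof. by case: i v => [|i] v; [apply: aug_exact | apply: dif_exact]. Qed.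

Lemma cdif_image (v : 'rV[R]_1) : I (v 0 0) <-> exists w, v = w *m cdif F 0.
Proof.
have e1 : v = (v 0 0)%:M by apply/matrixP=> i j; rewrite !ord1 mxE.
rewrite (aug_image F); split=> -[w hw]; exists w.
  by rewrite /= hw -e1.
by rewrite -e1 hw.
Qed.

Lemma cdif_cdif i : cdif F i.+1 *m cdif F i = 0.
Proof.
apply/row_matrixP => s; rewrite row_mul row0.
by apply/cdif_exact; exists (delta_mx 0 s); rewrite rowE.
Qed.

Lemma cdif_lift i p (e : 'I_p -> int) (A : 'M_(p, crk F i.+1)) :
  homog_mx e (@cdg I F i.+1) A -> A *m cdif F i = 0 ->
  exists2 B, homog_mx e (@cdg I F i.+2) B & A = B *m cdif F i.+1.
Proof.
move=> hA A0; apply: homog_mx_factor hA (@cdif_homog i.+1) _ => s.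
by apply/cdif_exact; rewrite -row_mul A0 row0.
Qed.

End Basics.

(** Multiplication by [q] is a map [R / L -> R / J] of degree [e], and it lifts
    to resolutions one position at a time: the composite with the next
    differential of [G] is killed by the differential of [F], so it factors
    through the following one by exactness.  All modules being given by
    homogeneous matrices, the factors can be taken homogeneous. *)
Lemma comparison L J (G : graded_free_resolution L)
    (F : graded_free_resolution J) (e : int) (q : R) :
  homog_elt e q -> (forall p, L p -> J (p * q)) ->
  exists phi : forall i, 'M[R]_(crk G i, crk F i),
    [/\ phi 0%N = q%:M,
        forall i, homog_mx (fun s => @cdg L G i s + e) (@cdg J F i) (phi i)
      & forall i, cdif G i *m phi i = phi i.+1 *m cdif F i].
Proof.
move=> hq LJ.
pose hom i (A : 'M[R]_(crk G i, crk F i)) :=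
  homog_mx (fun s => @cdg L G i s + e) (@cdg J F i) A.
pose liftable i (A : 'M[R]_(crk G i, crk F i)) := hom i A /\
  exists2 B, hom i.+1 B & cdif G i *m A = B *m cdif F i.
have hcom i A : hom i A -> homog_mx (fun s => @cdg L G i.+1 s + e)
    (@cdg J F i) (cdif G i *m A).
  move=> hA; apply: homog_mxM hA => s t.
  by rewrite opprD addrACA subrr addr0; apply: cdif_homog.
have base : liftable 0%N q%:M.
  have h0 : hom 0%N q%:M.
    by move=> s t; rewrite mxE !ord1 /= mulr1n add0r subr0.
  split=> //; apply: homog_mx_factor (hcom _ _ h0) (@cdif_homog _ F 0) _ => s.
  apply/cdif_image; rewrite row_mul mul_mx_scalar mxE mulrC.
  by apply: LJ; apply/(cdif_image G); exists (delta_mx 0 s); rewrite rowE.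
have [i A [hA [B hB AB]]|phi [phi0 hphi cphi]] :=
  @dependent_choice_nat (fun i => 'M[R]_(crk G i, crk F i)) liftable
    (fun i A B => cdif G i *m A = B *m cdif F i) q%:M base.
  exists B => //; split=> //; apply: cdif_lift; first exact: hcom.
  by rewrite -mulmxA -AB mulmxA cdif_cdif mul0mx.
by exists phi; split=> // i; case: (hphi i).
Qed.

(** The homotopy is built one position at a time: what [theta] lacks to agree
    with the part of the homotopy already found consists of cycles, which are
    boundaries by exactness.  It starts with 0 in position 0, and this matters
    later: the constant terms of the augmentation need not vanish, so the
    summand through position 0 must. *)
Lemma null_homotopy J (F : graded_free_resolution J)
    (theta : forall i, 'M[R]_(crk F i, crk F i)) :
  theta 0%N = 0 ->
  (forall i, homog_mx (@cdg J F i) (@cdg J F i) (theta i)) ->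
  (forall i, cdif F i *m theta i = theta i.+1 *m cdif F i) ->
  exists h : forall i, 'M[R]_(crk F i, crk F i.+1),
    [/\ h 0%N = 0, forall i, homog_mx (@cdg J F i) (@cdg J F i.+1) (h i)
      & forall i, theta i.+1 = h i.+1 *m cdif F i.+1 + cdif F i *m h i].
Proof.
move=> theta0 hth cth.
pose P i (h : 'M[R]_(crk F i, crk F i.+1)) :=
  homog_mx (@cdg J F i) (@cdg J F i.+1) h /\
  cdif F i *m theta i = cdif F i *m (h *m cdif F i).
have P0 : P 0%N 0.
  by split; [apply: homog_mx0 | rewrite theta0 mul0mx].
have [i h [hh hd]|h [h0 Ph Eh]] := @dependent_choice_nat
  (fun i => 'M[R]_(crk F i, crk F i.+1)) P
  (fun i h h' => theta i.+1 = h' *m cdif F i.+1 + cdif F i *m h) 0 P0.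
  have [||B hB eB] := @cdif_lift J F i _ (@cdg J F i.+1)
      (theta i.+1 - cdif F i *m h).
  - apply: homog_mxD => //; apply: homog_mxN.
    exact: homog_mxM (@cdif_homog J F i) hh.
  - by rewrite mulmxBl -cth hd mulmxA subrr.
  have eth : theta i.+1 = B *m cdif F i.+1 + cdif F i *m h.
    by rewrite -eB subrK.
  exists B => //; split=> //.
  rewrite eth mulmxDr [cdif _ _ *m (cdif _ _ *m h)]mulmxA cdif_cdif mul0mx.
  by rewrite addr0.
by exists h; split=> // i; case: (Ph i).
Qed.

End Resolutions.

(** * Independence of Tor from the resolution *)

(** A map [phi] of homology groups [Z/B -> Z'/B'] with a left inverse [psi] is
    injective.  Its kernel is cut out of [Z] by composing [phi] with the
    quotient by [B'], which turns the claim into rank equations. *)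
Lemma homology_dim_le (K : fieldType) (p q a b c e : nat)
    (Z : 'M[K]_(a, p)) (B : 'M[K]_(b, p)) (Z' : 'M[K]_(c, q))
    (B' : 'M[K]_(e, q)) (phi : 'M[K]_(p, q)) (psi : 'M[K]_(q, p)) :
  (Z *m phi <= Z')%MS -> (B' *m psi <= B)%MS -> (B' <= Z')%MS ->
  (Z *m (phi *m psi - 1%:M) <= B)%MS ->
  (\rank Z - \rank B <= \rank Z' - \rank B')%N.
Proof.
move=> hphi hpsi hB' hZ.
pose C := cokermx B'.
have inB : (Z :&: kermx (phi *m C) <= B)%MS.
  apply/rV_subP => v; rewrite sub_capmx => /andP[/submxP[w ->]].
  move/sub_kermxP; rewrite mulmxA => hv.
  have h1 : (w *m Z *m phi <= B')%MS by rewrite submxE; apply/eqP.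
  have h2 : (w *m Z *m phi *m psi <= B)%MS.
    exact: submx_trans (submxMr psi h1) hpsi.
  have -> : w *m Z = w *m Z *m phi *m psi - w *m (Z *m (phi *m psi - 1%:M)).
    by rewrite !mulmxBr mulmx1 !mulmxA opprB addrC subrK.
  rewrite addmx_sub // eqmx_opp.
  exact: submx_trans (submxMl _ _) hZ.
have inK : (B' <= Z' :&: kermx C)%MS.
  by rewrite sub_capmx hB'; apply/sub_kermxP; rewrite mulmx_coker.
have := mxrank_mul_ker Z (phi *m C); have := mxrank_mul_ker Z' C.
have := mxrankS inB; have := mxrankS inK.
have : (\rank (Z *m (phi *m C)) <= \rank (Z' *m C))%N.
  by apply: mxrankS; rewrite mulmxA; apply: submxMr.
move: (\rank _) (\rank _) (\rank _) (\rank _) => x y u v h1 h2 h3 <- <-.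
apply: (@leq_trans v); first by rewrite leq_subLR addnC leq_add2r.
by rewrite -addnBA // (leq_trans h1) ?leq_addr.
Qed.

Section TorInvariance.
Variables (K : fieldType) (n : nat).
Local Notation R := {mpoly K[n]}.
Local Notation const_terms := (map_mx (@mcoeff n K 0%MM)).

(** The entries of a degree-preserving matrix that survive modulo the variables
    have degree 0, so they relate basis elements of equal degree. *)
Lemma degree_piece_commute (a b : nat) (e : 'I_a -> int) (e' : 'I_b -> int)
    (A : 'M[R]_(a, b)) (j : int) : homog_mx e e' A ->
  diag_mx (\row_s (e s == j)%:R) *m const_terms A
    = const_terms A *m diag_mx (\row_s (e' s == j)%:R).
Proof.
move=> hA; apply/matrixP => s t; rewrite mul_diag_mx mul_mx_diag !mxE mulrC.
have [->|A0] := eqVneq (A s t)@_0%MM 0; first by rewrite !mul0r.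
have /homog_eltP/(_ _ A0)/eqP := hA s t.
by rewrite mdeg0 eq_sym subr_eq0 => /eqP->.
Qed.

Section ChainMap.
Variables (I : R -> Prop) (F G : graded_free_resolution I).
Variable phi : forall i, 'M[R]_(crk F i, crk G i).
Hypothesis hphi : forall i, homog_mx (@cdg K n I F i) (@cdg K n I G i) (phi i).
Hypothesis cphi : forall i, cdif F i *m phi i = phi i.+1 *m cdif G i.

Lemma tor_difM i :
  tor_dif F i *m const_terms (phi i.+1)
    = const_terms (phi i.+2) *m tor_dif G i.
Proof.
by have := congr1 const_terms (cphi i.+1); rewrite !map_mxM.
Qed.

Lemma tor_kerM i :
  (tor_ker F i *m const_terms (phi i.+1) <= tor_ker G i)%MS.
Proof.
case: i => [|i] /=; first exact: submx1.
by apply/sub_kermxP; rewrite -mulmxA -tor_difM mulmxA mulmx_ker mul0mx.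
Qed.

Lemma tor_pieceM i j :
  tor_piece F i j *m const_terms (phi i.+1)
    = const_terms (phi i.+1) *m tor_piece G i j.
Proof. exact: degree_piece_commute (@hphi i.+1). Qed.

Lemma tor_cyclesM i j :
  (tor_cycles F i j *m const_terms (phi i.+1) <= tor_cycles G i j)%MS.
Proof.
rewrite sub_capmx; apply/andP; split.
  apply: submx_trans (submxMr _ (capmxSl _ _)) _.
  by rewrite tor_pieceM submxMl.
exact: submx_trans (submxMr _ (capmxSr _ _)) (tor_kerM i).
Qed.

Lemma tor_boundariesM i j :
  (tor_boundaries F i j *m const_terms (phi i.+1) <= tor_boundaries G i j)%MS.
Proof.
by rewrite -mulmxA tor_difM mulmxA tor_pieceM -mulmxA submxMl.
Qed.

End ChainMap.

Lemma tor_boundaries_sub (I : R -> Prop) (F : graded_free_resolution I) i j :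
  (tor_boundaries F i j <= tor_cycles F i j)%MS.
Proof.
rewrite sub_capmx; apply/andP; split.
  rewrite /tor_boundaries (degree_piece_commute _ (@cdif_homog K n I F i.+1)).
  exact: submxMl.
case: i => [|i] /=; first exact: submx1.
apply/sub_kermxP; rewrite -mulmxA -map_mxM.
by rewrite (@cdif_cdif K n I F i.+1) map_mx0 mulmx0.
Qed.

(** Comparison maps in both directions compose to an endomorphism of [F]
    homotopic to the identity, so [Tor] computed from [F] embeds in [Tor]
    computed from [G]. *)
Lemma tor_dim_le (I : R -> Prop) (F G : graded_free_resolution I) i j :
  (tor_dim F i j <= tor_dim G i j)%N.
Proof.
have q1 : forall p : R, I p -> I (p * 1) by move=> p; rewrite mulr1.
have h1 : homog_elt 0 (1 : R) by apply: dhomog1.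
have homog0 (a b : nat) (e : 'I_a -> int) (e' : 'I_b -> int)
    (A : 'M[R]_(a, b)) :
    homog_mx (fun s => e s + 0) e' A -> homog_mx e e' A.
  by move=> hA s t; have := hA s t; rewrite addr0.
have [phi [phi0 /(_ _)/homog0 hphi cphi]] := comparison F G h1 q1.
have [psi [psi0 /(_ _)/homog0 hpsi cpsi]] := comparison G F h1 q1.
have [|||h [h0 hh eh]] := @null_homotopy K n I F
    (fun i => phi i *m psi i - 1%:M).
- by rewrite phi0 psi0 -scalar_mxM mulr1 subrr.
- move=> k; apply: homog_mxD; first exact: homog_mxM (hphi k) (hpsi k).
  apply: homog_mxN => s t; rewrite mxE; case: eqP => [->|_].
    by rewrite subrr.
  exact: homog_elt0.
- move=> k; rewrite mulmxBr mulmxBl mulmx1 mul1mx mulmxA cphi -!mulmxA.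
  by rewrite cpsi.
apply: (homology_dim_le (tor_cyclesM hphi cphi i j)
         (tor_boundariesM hpsi cpsi i j) (tor_boundaries_sub G i j)).
rewrite -map_mxM -(map_mx1 (@mcoeff n K 0%MM)) -map_mxB eh map_mxD !map_mxM.
rewrite mulmxDr addmx_sub //.
  apply: submx_trans (submxMr _ (capmxSl _ _)) _.
  rewrite mulmxA (degree_piece_commute j (hh i.+1)) -mulmxA.
  exact: submxMl.
case: i => [|i]; first by rewrite h0 map_mx0 !mulmx0 sub0mx.
have /submxP[w ->] : (tor_cycles F i.+1 j <= tor_ker F i.+1)%MS.
  exact: capmxSr.
by rewrite -mulmxA [kermx _ *m _]mulmxA mulmx_ker mul0mx mulmx0 sub0mx.
Qed.

Lemma tor_dim_unique (I : R -> Prop) (F G : graded_free_resolution I) i j :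
  tor_dim F i j = tor_dim G i j.
Proof. by apply/eqP; rewrite eqn_leq !tor_dim_le. Qed.

End TorInvariance.

(** * The mapping cone *)

Section Cone.
Variables (K : fieldType) (n : nat).
Local Notation R := {mpoly K[n]}.

Definition ideal_add (J : R -> Prop) (q : R) : R -> Prop :=
  fun p => exists u v, J u /\ p = u + v * q.

Section ConeComplex.
Variables (L J : R -> Prop).
Variables (G : graded_free_resolution L) (F : graded_free_resolution J).
Variables (e : int) (q : R) (phi : forall i, 'M[R]_(crk G i, crk F i)).
Arguments phi : clear implicits.
Hypothesis LJ : forall p, L p <-> J (p * q).
Hypothesis phi0 : phi 0%N = q%:M.
Hypothesis hphi :
  forall i, homog_mx (fun s => @cdg K n L G i s + e) (@cdg K n J F i) (phi i).
Hypothesis cphi : forall i, cdif G i *m phi i = phi i.+1 *m cdif F i.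

Definition cone_rk (i : nat) : nat := (rk F i + crk G i)%N.

Definition cone_dg (i : nat) (s : 'I_(cone_rk i)) : int :=
  match split s with inl t => dg t | inr t => @cdg K n L G i t + e end.

Definition cone_aug : 'cV[R]_(cone_rk 0) := col_mx (aug F) (phi 0%N).

Definition cone_dif (i : nat) : 'M[R]_(cone_rk i.+1, cone_rk i) :=
  block_mx (dif F i) 0 (phi i.+1) (- cdif G i).

Lemma cone_dg_lshift i s : @cone_dg i (lshift _ s) = dg s.
Proof. by rewrite /cone_dg (unsplitK (inl s)). Qed.

Lemma cone_dg_rshift i s : @cone_dg i (rshift _ s) = @cdg K n L G i s + e.
Proof. by rewrite /cone_dg (unsplitK (inr s)). Qed.

Lemma cone_aug_homog s : homog_elt (cone_dg s) (cone_aug s 0).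
Proof.
case: (split_ordP s) => t ->.
  by rewrite cone_dg_lshift col_mxEu; apply: aug_homog.
by rewrite cone_dg_rshift col_mxEd -[_ + e]subr0; apply: (@hphi 0).
Qed.

Lemma cone_dif_homog i s t : homog_elt (cone_dg s - cone_dg t) (cone_dif i s t).
Proof.
case: (split_ordP s) => s' ->; case: (split_ordP t) => t' ->;
  rewrite ?cone_dg_lshift ?cone_dg_rshift.
- by rewrite block_mxEul; apply: dif_homog.
- by rewrite block_mxEur mxE; apply: homog_elt0.
- by rewrite block_mxEdl; apply: (@hphi i.+1).
rewrite block_mxEdr mxE opprD addrACA subrr addr0.
by apply: homog_eltN; apply: cdif_homog.
Qed.

Lemma cone_aug_image p :
  ideal_add J q p <-> exists v : 'rV_(cone_rk 0), v *m cone_aug = p%:M.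
Proof.
split=> [[u [v [/(aug_image F)[w hw] ->]]]|[v]].
  exists (row_mx w v%:M).
  by rewrite mul_row_col hw phi0 -scalar_mxM -raddfD.
rewrite -[v]hsubmxK mul_row_col phi0 mul_mx_scalar.
set w := lsubmx v; set x := rsubmx v => hp.
exists ((w *m aug F) 0 0), (x 0 0); split.
  apply/(aug_image F); exists w.
  by apply/matrixP => i j; rewrite !ord1 [RHS]mxE.
have := congr1 (fun M : 'M_1 => M 0 0) hp.
by rewrite /= !mxE mulr1n => <-; rewrite [q * _]mulrC.
Qed.

(** A cycle of the cone is a cycle [w] of [G] whose image under [phi] is
    bounded in [F] by [- u]; correcting [u] by the image of a preimage of [w]
    leaves a cycle of [F]. *)
Lemma cone_exact_step i (u : 'rV_(rk F i)) (w : 'rV_(crk G i)) :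
  u *m cdif F i + w *m phi i = 0 -> (exists w', w = w' *m cdif G i) ->
  exists x, row_mx u w = x *m cone_dif i.
Proof.
move=> uw [w' ew].
have [u' eu] : exists u', u + w' *m phi i.+1 = u' *m dif F i.
  apply/(@cdif_exact K n J F i).
  by rewrite mulmxDl -mulmxA -cphi mulmxA -ew.
exists (row_mx u' (- w')); rewrite mul_row_block mulmx0 add0r mulmxN.
by rewrite -eu !mulNmx opprK addrK ew.
Qed.

Lemma cone_aug_exact (v : 'rV_(cone_rk 0)) :
  v *m cone_aug = 0 <-> exists w : 'rV_(cone_rk 1), v = w *m cone_dif 0.
Proof.
rewrite -[v]hsubmxK; split.
  rewrite mul_row_col => h; apply: cone_exact_step => //.
  apply/cdif_image/LJ/(aug_image F); exists (- lsubmx v).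
  move/eqP: h; rewrite addrC addr_eq0 phi0 mul_mx_scalar mulNmx => /eqP <-.
  by apply/matrixP => i j; rewrite !ord1 !mxE mulr1n mulrC.
case=> w ->; rewrite -[w]hsubmxK mul_row_block mul_row_col.
rewrite mulmx0 add0r mulmxDl -!mulmxA (@cdif_cdif K n J F 0) mulmx0 add0r.
by rewrite mulNmx cphi mulmxN addrN.
Qed.

Lemma cone_dif_exact i (v : 'rV_(cone_rk i.+1)) :
  v *m cone_dif i = 0 <-> exists w : 'rV_(cone_rk i.+2), v = w *m cone_dif i.+1.
Proof.
rewrite -[v]hsubmxK; split.
  rewrite mul_row_block mulmx0 add0r mulmxN -[0]row_mx0.
  move=> /eq_row_mx[h1 /eqP]; rewrite oppr_eq0 => /eqP h2.
  by apply: cone_exact_step => //; apply/cdif_exact.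
case=> w ->; rewrite -[w]hsubmxK !mul_row_block !mulmx0 !add0r.
rewrite !mulmxDl -!mulmxA (@cdif_cdif K n J F i.+1) mulmx0 add0r.
rewrite mulNmx cphi mulmxN addrN mulmxN mulNmx opprK cdif_cdif mulmx0.
exact: row_mx0.
Qed.

Definition cone : graded_free_resolution (ideal_add J q) :=
  GradedFreeResolution cone_aug_homog cone_dif_homog cone_aug_image
    cone_aug_exact cone_dif_exact.

End ConeComplex.

(** Betti numbers are bounded by the pairs (position, degree) of the basis
    elements of a resolution, so [P] records only which pairs may occur. *)
Definition resolved_within (P : nat -> int -> Prop) (I : R -> Prop) : Prop :=
  exists F : graded_free_resolution I,
    forall i (s : 'I_(crk F i)), P i (@cdg K n I F i s).

Lemma resolved_within_ext P I J :
  (forall p, I p <-> J p) -> resolved_within P I -> resolved_within P J.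
Proof.
move=> IJ [[rk dg aug dif h1 h2 h3 h4 h5] hP].
have h3' p : J p <-> exists v : 'rV_(rk 0), v *m aug = p%:M.
  by rewrite -IJ.
by exists (GradedFreeResolution h1 h2 h3' h4 h5).
Qed.

Lemma resolved_within_sub (P Q : nat -> int -> Prop) I :
  (forall i j, P i j -> Q i j) -> resolved_within P I -> resolved_within Q I.
Proof. by move=> PQ [F hF]; exists F => i s; apply: PQ. Qed.

Lemma resolved_within0 :
  resolved_within (fun i j => i = 0%N /\ j = 0) (fun p => p = 0).
Proof.
have mx0 (i : nat) (A : 'M[R]_(i, 0)) : A = 0.
  by apply/matrixP => ? [].
have h1 (s : 'I_0) : homog_elt (0 : int) ((0 : 'cV[R]_0) s 0) by case: s.
have h2 (i : nat) (s t : 'I_0) :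
  homog_elt (0 - 0 : int) ((0 : 'M[R]_(0, 0)) s t) by case: s.
have h3 (p : R) : p = 0 <-> exists v : 'rV_0, v *m (0 : 'cV[R]_0) = p%:M.
  split=> [->|[v]]; first by exists 0; rewrite mul0mx raddf0.
  rewrite mulmx0 => /(congr1 (fun M : 'M_1 => M 0 0)).
  by rewrite !mxE mulr1n.
have h4 (v : 'rV[R]_0) :
  v *m (0 : 'cV[R]_0) = 0 <-> exists w : 'rV_0, v = w *m (0 : 'M[R]_(0, 0)).
  by split=> _; [exists 0; rewrite (mx0 _ v) mul0mx | rewrite mulmx0].
have h5 (i : nat) (v : 'rV[R]_0) :
  v *m (0 : 'M[R]_(0, 0)) = 0 <-> exists w : 'rV_0, v = w *m (0 : 'M[R]_(0, 0)).
  by split=> _; [exists 0; rewrite (mx0 _ v) mul0mx | rewrite mulmx0].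
exists (@GradedFreeResolution K n _ (fun=> 0%N) (fun _ _ => 0) _ _
          h1 h2 h3 h4 h5).
by case=> [|i] //= [].
Qed.

(** The mapping cone of multiplication by [q] from [R / (J : q)] to [R / J]
    resolves [R / (J + (q))]. *)
Lemma resolved_within_cone (P Q : nat -> int -> Prop) (J : R -> Prop)
    (e : int) (q : R) :
  homog_elt e q -> resolved_within P J -> resolved_within Q (colon J q) ->
  resolved_within
    (fun i j => P i j \/ if i is i'.+1 then Q i' (j - e) else False)
    (ideal_add J q).
Proof.
move=> hq [F hF] [G hG].
have [phi [phi0 hphi cphi]] := comparison G F hq (fun p h => h).
exists (@cone _ J G F e q phi (fun p => iff_refl _) phi0 hphi cphi).
case=> [|i] s; first by left; apply: (hF 0%N).
rewrite /= /cone_dg; case: (split s) => t; [left | right].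
  exact: (hF i.+1).
by rewrite addrK; apply: hG.
Qed.

(** Nakayama's lemma.  If [Tor_0] vanishes, then the constant terms of the first
    differential generate the whole space, so some multiple [M] of that
    differential has the unit matrix as constant terms.  As [M] kills the
    generators of [I], so does its determinant, which is nonzero because its
    constant term is 1. *)
Lemma tor0_neq0 (I : R -> Prop) (F : graded_free_resolution I) :
  (exists2 p, I p & p != 0) -> exists j, tor_dim F 0 j != 0%N.
Proof.
case=> p /(aug_image F)[v hv] p0.
have [/existsP[s hs]|/existsPn h0] :=
  boolP [exists s : 'I_(rk F 0), tor_dim F 0 (dg s) != 0%N].
  by exists (dg s).
have gen s : (delta_mx 0 s <= tor_dif F 0)%MS.
  have cyc_bound : (tor_cycles F 0 (dg s) <= tor_boundaries F 0 (dg s))%MS.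
    rewrite -(geq_leqif (mxrank_leqif_sup (tor_boundaries_sub F 0 (dg s)))).
    by rewrite -subn_eq0; apply/eqP; have := h0 s; rewrite negbK => /eqP.
  apply: submx_trans (submx_trans cyc_bound (submxMl _ _)).
  rewrite sub_capmx submx1 andbT; apply/submxP; exists (delta_mx 0 s).
  apply/matrixP => i t; rewrite mul_mx_diag !mxE.
  by case: (t =P s) => [->|]; rewrite ?eqxx ?mulr1 // andbF mul0r.
have /submxP[E hE] : (1%:M <= tor_dif F 0)%MS.
  by apply/row_subP => s; rewrite rowE mulmx1.
pose M := map_mx (mpolyC n (R := K)) E *m dif F 0.
have ev1 : map_mx (mcoeff 0%MM) M = 1%:M.
  rewrite map_mxM -map_mx_comp hE; congr (_ *m _).
  by apply/matrixP => i j; rewrite !mxE /= mpolyCK.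
have det0 : \det M != 0.
  apply: contraTneq (oner_neq0 K) => /(congr1 (mcoeff 0%MM)).
  by rewrite -det_map_mx ev1 det1 mcoeff0 => ->; rewrite eqxx.
have /eqP : \det M *: aug F = 0.
  rewrite -mul_scalar_mx -mul_adj_mx -!mulmxA (@cdif_cdif K n I F 0).
  by rewrite !mulmx0.
rewrite scalemx_eq0 (negPf det0) /= => /eqP a0.
move: hv; rewrite a0 mulmx0 => /(congr1 (fun M : 'M_1 => M 0 0)).
by rewrite !mxE mulr1n => /esym/eqP; rewrite (negPf p0).
Qed.

End Cone.

(** * Ideals generated by a sequence *)

Lemma big_ord_ltS (T : Type) (idx : T) (op : Monoid.com_law idx) m (k : 'I_m)
    (F : 'I_m -> T) :
  \big[op/idx]_(l < m | (l < k.+1)%N) F l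
    = op (\big[op/idx]_(l < m | (l < k)%N) F l) (F k).
Proof.
rewrite (bigD1 k) //= Monoid.mulmC; congr (op _ _); apply: eq_bigl => l.
by rewrite ltnS ltn_neqAle andbC.
Qed.

Lemma forall_ord_ltS m (k : 'I_m) (P : pred 'I_m) :
  [forall l : 'I_m, (l < k.+1)%N ==> P l]
    = [forall l : 'I_m, (l < k)%N ==> P l] && P k.
Proof. by rewrite -!big_andE big_ord_ltS. Qed.

Section GeneratedIdeals.
Variables (K : fieldType) (n : nat).
Local Notation R := {mpoly K[n]}.

Lemma ideal_genD (T : finType) (g : T -> R) P p q :
  ideal_gen g P p -> ideal_gen g P q -> ideal_gen g P (p + q).
Proof.
case=> c -> [c' ->]; exists (fun i => c i + c' i).
by rewrite -big_split; apply: eq_bigr => i _; rewrite mulrDl.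
Qed.

Lemma ideal_genM (T : finType) (g : T -> R) P p q :
  ideal_gen g P p -> ideal_gen g P (q * p).
Proof.
case=> c ->; exists (fun i => q * c i).
by rewrite mulr_sumr; apply: eq_bigr => i _; rewrite mulrA.
Qed.

Lemma ideal_gen_pred0 (T : finType) (g : T -> R) P :
  P =1 xpred0 -> forall p, ideal_gen g P p <-> p = 0.
Proof.
move=> P0 p; split=> [[c ->]|->]; first by rewrite big_pred0.
by exists (fun=> 0); rewrite big_pred0.
Qed.

Lemma ideal_gen_eqpred (T : finType) (g : T -> R) P Q :
  P =1 Q -> forall p, ideal_gen g P p <-> ideal_gen g Q p.
Proof.
by move=> PQ p; split=> -[c ->]; exists c; apply: eq_bigl => i; rewrite PQ.
Qed.

Lemma ideal_gen_in (T : finType) (g : T -> R) (P : pred T) i :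
  P i -> ideal_gen g P (g i).
Proof.
move=> Pi; exists (fun k => (k == i)%:R); rewrite (bigD1 i) //= eqxx mul1r.
by rewrite big1 ?addr0 // => k /andP[_ /negPf->]; rewrite mul0r.
Qed.

Lemma ideal_gen_ltS m (g : 'I_m -> R) (k : 'I_m) p :
  ideal_gen g [pred l : 'I_m | l < k.+1]%N p <->
  ideal_add (ideal_gen g [pred l : 'I_m | l < k]%N) (g k) p.
Proof.
split=> [[c ->]|[_ [v [[c ->] ->]]]].
  rewrite big_ord_ltS.
  by exists (\sum_(l < m | (l < k)%N) c l * g l), (c k); split; [exists c|].
exists (fun l => if l == k then v else c l); rewrite big_ord_ltS eqxx.
congr (_ + _); apply: eq_bigr => l lk; rewrite ifN //.
by apply: contraTneq lk => -> /=; rewrite ltnn.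
Qed.

(** Iterated mapping cones, starting from the zero ideal: each basis element
    comes from the resolution of one of the colon ideals, one position lower
    and with the degree of the corresponding generator removed. *)
Lemma resolved_within_iter m (g : 'I_m -> R) (e : 'I_m -> int)
    (Q : 'I_m -> nat -> int -> Prop) :
  (forall l, homog_elt (e l) (g l)) ->
  (forall l : 'I_m, resolved_within (Q l)
    (colon (ideal_gen g [pred l' : 'I_m | l' < l]%N) (g l))) ->
  resolved_within
    (fun i j => if i is i'.+1 then exists l, Q l i' (j - e l) else j = 0)
    (ideal_gen g xpredT).
Proof.
move=> hg hQ.
suff step k : (k <= m)%N -> resolved_within
    (fun i j => if i is i'.+1 then exists l, Q l i' (j - e l) else j = 0)
    (ideal_gen g [pred l : 'I_m | l < k]%N).
  apply: resolved_within_ext (step m (leqnn m)).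
  by apply: ideal_gen_eqpred => l; rewrite /= ltn_ord.
elim: k => [_|k IH km].
  apply: resolved_within_ext (resolved_within_sub _ (resolved_within0 K n)).
    by move=> p; apply: iff_sym; apply: ideal_gen_pred0.
  by move=> i j [-> ->].
have := resolved_within_cone (hg (Ordinal km)) (IH (ltnW km)) (hQ (Ordinal km)).
move=> h; apply: resolved_within_ext (resolved_within_sub _ h).
  by move=> p; apply: iff_sym; apply: (ideal_gen_ltS g (Ordinal km)).
by case=> [|i] j [] // hj; exists (Ordinal km).
Qed.

(** The Koszul complex as an iterated mapping cone: regularity says that the
    ideal [J] of the members before [g k] equals [J : g k], so a single
    resolution serves as source and target of the multiplication by [g k]. *)
Lemma resolved_within_koszul r (g : 'I_r -> R) (a : 'I_r -> nat) :
  (forall i, homog_elt (a i)%:Z (g i)) -> (forall i, (0 < a i)%N) ->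
  regular_sequence g ->
  resolved_within
    (fun i j => (i <= r)%N /\ j - i%:Z <= \sum_(l < r) ((a l)%:Z - 1))
    (ideal_gen g xpredT).
Proof.
move=> hg a_gt0 [reg _].
pose B k : int := \sum_(l < r | (l < k)%N) ((a l)%:Z - 1).
suff step k : (k <= r)%N -> resolved_within
    (fun i j => (i <= k)%N /\ j - i%:Z <= B k)
    (ideal_gen g [pred l : 'I_r | l < k]%N).
  have := step r (leqnn r); rewrite /B (eq_bigl xpredT); last exact: ltn_ord.
  by apply: resolved_within_ext; apply: ideal_gen_eqpred => l; apply: ltn_ord.
elim: k => [_|k IH kr].
  apply: resolved_within_ext (resolved_within_sub _ (resolved_within0 K n)).
    by move=> p; apply: iff_sym; apply: ideal_gen_pred0.
  by move=> i j [-> ->]; rewrite /B big_pred0.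
have {}IH := IH (ltnW kr).
pose k' := Ordinal kr.
have colon_k p : ideal_gen g [pred l : 'I_r | l < k]%N p <->
    colon (ideal_gen g [pred l : 'I_r | l < k]%N) (g k') p.
  split=> [h|]; rewrite /colon mulrC; first exact: ideal_genM.
  exact: (reg k').
have := resolved_within_cone (hg k') IH (resolved_within_ext colon_k IH).
move=> h; apply: resolved_within_ext (resolved_within_sub _ h).
  by move=> p; apply: iff_sym; apply: (ideal_gen_ltS g k').
have -> : B k.+1 = B k + ((a k')%:Z - 1).
  exact: (big_ord_ltS _ k').
have ak := a_gt0 k'; move: {IH h} (B k) => b.
by case=> [|i] j [] // [hi hj]; split; lia.
Qed.

End GeneratedIdeals.

(** * Monomial ideals *)

Section MonomialIdeals.
Variables (K : fieldType) (n : nat).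
Local Notation R := {mpoly K[n]}.

Lemma monomial_idealP (T : finType) (f : T -> 'X_{1..n}) (P : pred T) (p : R) :
  ideal_gen (fun i => 'X_[K, f i]) P p <->
  forall m, p@_m != 0 -> [exists i, P i && (f i <= m)%MM].
Proof.
split=> [[c ->] m|h].
  apply: contraR => /existsPn nex; rewrite raddf_sum /= big1 // => i Pi.
  apply/eqP; apply: contraT => /mcoeffM_neq0[k [l [mkl _]]].
  rewrite mcoeffX; case: (f i =P l) => [fl _|_]; last by rewrite eqxx.
  by have := nex i; rewrite Pi mkl fl lem_addl.
rewrite [p]mpolyE big_seq; apply: big_ind.
- by exists (fun=> 0); rewrite big1 // => i _; rewrite mul0r.
- by move=> x y; apply: ideal_genD.
move=> m; rewrite mcoeff_msupp => /h/existsP[i /andP[Pi fm]].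
rewrite -(submK fm) mpolyXD scalerAl.
by apply: ideal_genM; apply: (ideal_gen_in (fun i => 'X_[K, f i])).
Qed.

Lemma monomial_ideal_X (T : finType) (f : T -> 'X_{1..n}) (P : pred T) m :
  ideal_gen (fun i => 'X_[K, f i]) P 'X_[m] <->
  [exists i, P i && (f i <= m)%MM].
Proof.
rewrite monomial_idealP; split=> [|h m'].
  by apply; rewrite mcoeffX eqxx oner_neq0.
by rewrite mcoeffX; case: (m =P m') => [<- //|_]; rewrite eqxx.
Qed.

(** Monomial ideals are determined by their monomials, which turns an equation
    between a colon ideal and a monomial ideal into one about divisibility. *)
Lemma monomial_colonE (T U : finType) (f : T -> 'X_{1..n}) (P : pred T) q
    (g : U -> 'X_{1..n}) :
  (forall p, colon (ideal_gen (fun i => 'X_[K, f i]) P) 'X_[q] p <->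
             ideal_gen (fun i => 'X_[K, g i]) xpredT p) ->
  forall x, [exists i, P i && (f i <= x + q)%MM] = [exists i, (g i <= x)%MM].
Proof.
move=> fg x; have := fg 'X_[x].
rewrite /colon -mpolyXD !monomial_ideal_X => fgx.
by apply/idP/idP => /fgx.
Qed.

Lemma minimal_generators_nmid m (f : 'I_m -> 'X_{1..n}) (k l : 'I_m) :
minimal_generators (fun i => 'X_[K, f i]) -> k != l -> ~~ (f k <= f l)%MM.
Proof.
move=> hmin kl; apply/negP => le; apply: (hmin [set~ l]).
  by rewrite properE subsetT; apply/subsetPn; exists l; rewrite ?inE ?eqxx.
move=> p; rewrite !monomial_idealP; split=> h x /h/existsP[i /andP[il fi]].
  by apply/existsP; exists i.
apply/existsP; have [ei|ni] := eqVneq i l; last first.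
  by exists i; rewrite fi andbT; change (i \in [set~ l]); rewrite !inE.
exists k; apply/andP; split; first by change (k \in [set~ l]); rewrite !inE.
by apply: lepm_trans le _; rewrite -ei.
Qed.

(** The multiple [x f2] of [f1] is proper: otherwise [f2] would divide [f1]. *)
Lemma mdeg_lt_colon (f1 f2 x : 'X_{1..n}) :
  (f1 <= x + f2)%MM -> ~~ (f2 <= f1)%MM -> (mdeg f1 < mdeg x + mdeg f2)%N.
Proof.
move=> f1x; apply: contraR; rewrite -leqNgt -mdegD -{1}(submK f1x) mdegD.
rewrite -[X in (_ <= X)%N]add0n leq_add2r leqn0 mdeg_eq0 => /eqP e0.
by have := submK f1x; rewrite e0 add0m => ->; apply: lem_addl.
Qed.

End MonomialIdeals.

(** * Counting monomials *)

Lemma sum_bin_diag n d : (\sum_(i < d.+1) 'C(i + n, i) = 'C(d + n.+1, d))%N.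
Proof.
elim: d => [|d IH]; first by rewrite big_ord1 !bin0.
by rewrite big_ord_recr /= IH addSn addnS -addSnnS binS addnC.
Qed.

Lemma inv_one_sub_t_powE n d :
  inv_one_sub_t_pow n.+1 d = ('C(d + n, d))%:Z.
Proof.
elim: n d => [|n IH] d.
  rewrite /inv_one_sub_t_pow /= /series_mul big_ord_recr /= subnn mulr1.
  rewrite big1 ?add0r ?addn0 ?binn // => i _.
  by rewrite subn_eq0 leqNgt ltn_ord mulr0.
rewrite -[LHS]/(\sum_(i < d.+1) 1 * inv_one_sub_t_pow n.+1 (d - i)%N).
under eq_bigr do rewrite mul1r IH.
rewrite (reindex_inj rev_ord_inj) /= -sum_bin_diag.
rewrite (big_morph Posz PoszD (erefl _)); apply: eq_bigr => i _.
by congr ('C(_ + _, _))%:Z; have := ltn_ord i; lia.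
Qed.

Section HilbertSeries.
Variable n : nat.
Implicit Types (Q : {poly int}) (A B : pred 'X_{1..n}).

(** The coefficient of [t^d] in [Q / (1-t)^n]. *)
Definition over_pow Q d : int :=
  series_mul (inv_one_sub_t_pow n) (series_of_poly Q) d.

Lemma over_powB Q Q' d : over_pow (Q - Q') d = over_pow Q d - over_pow Q' d.
Proof.
rewrite /over_pow /series_mul -sumrB; apply: eq_bigr => i _.
by rewrite /series_of_poly coefB mulrBr.
Qed.

Lemma over_pow1 d : over_pow 1 d = inv_one_sub_t_pow n d.
Proof.
rewrite /over_pow /series_mul big_ord_recr /= big1 => [|i _].
  by rewrite add0r subnn /series_of_poly coef1 mulr1.
by rewrite /series_of_poly coef1 subn_eq0 leqNgt ltn_ord mulr0.
Qed.

Lemma over_powXM e Q d :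
  over_pow ('X^e * Q) d = if (d < e)%N then 0 else over_pow Q (d - e).
Proof.
rewrite /over_pow /series_mul /series_of_poly; case: ltnP => de.
  by rewrite big1 // => i _; rewrite coefXnM ifT ?mulr0 //; lia.
have -> : d.+1 = ((d - e).+1 + e)%N by lia.
rewrite big_split_ord /= [X in _ + X]big1 ?addr0 => [|i _]; last first.
  by rewrite coefXnM ifT ?mulr0 //; have := ltn_ord i; lia.
apply: eq_bigr => i _; have := ltn_ord i => ie.
rewrite coefXnM ifF; last by lia.
by congr (_ * Q`_ _); lia.
Qed.

Definition mons (d : nat) : seq 'X_{1..n} :=
  [seq s2m (val t) | t <- enum (basis n d)].

Lemma mem_mons d m : (m \in mons d) = (mdeg m == d).
Proof. by rewrite basis_cover. Qed.

Lemma uniq_mons d : uniq (mons d).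
Proof. exact: uniq_basis. Qed.

Lemma size_mons d : (size (mons d))%:Z = inv_one_sub_t_pow n d.
Proof.
case: (posnP n) => [n0|]; last first.
  by rewrite /mons; case: n => // k _; rewrite size_basis inv_one_sub_t_powE.
have all0 (m : 'X_{1..n}) : m = 0%MM.
  by apply/mnmP => -[i i_lt]; exfalso; move: i_lt; rewrite n0.
rewrite -(perm_size (_ : perm_eq (if d == 0%N then [:: 0%MM] else [::]) _)).
  by rewrite n0 /=; case: (d == 0%N).
apply: uniq_perm => [||m]; [by case: ifP | exact: uniq_mons |].
by rewrite mem_mons (all0 m) mdeg0 eq_sym; case: ifP; rewrite ?inE ?eqxx.
Qed.

Definition counted_by A Q :=
  forall d, (count A (mons d))%:Z = over_pow Q d.

Lemma counted_by_ext A B Q : A =1 B -> counted_by A Q -> counted_by B Q.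
Proof. by move=> AB h d; rewrite -h (eq_count AB). Qed.

Lemma counted_byT : counted_by xpredT 1.
Proof. by move=> d; rewrite count_predT size_mons over_pow1. Qed.

Lemma counted_byC A Q : counted_by A Q -> counted_by (predC A) (1 - Q).
Proof.
move=> h d; rewrite over_powB -h -counted_byT.
by rewrite [count xpredT _]count_predT -(count_predC A) PoszD addrC addKr.
Qed.

(** Multiplication by [f] is a bijection from the monomials in [B] of degree
    [d - deg f] to the monomials in [A] of degree [d] divisible by [f]. *)
Lemma counted_by_remove A B f Q Q' :
  B =1 (fun m => A (m + f)%MM) -> counted_by A Q -> counted_by B Q' ->
  counted_by (fun m => A m && ~~ (f <= m)%MM) (Q - 'X^(mdeg f) * Q').
Proof.
move=> BA hA hB d; rewrite over_powB over_powXM -hA.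
have -> : (if (d < mdeg f)%N then 0 else over_pow Q' (d - mdeg f))
   = (count (fun m => A m && (f <= m)%MM) (mons d))%:Z.
  case: ltnP => df.
    apply/esym/eqP; rewrite eqz_nat -leqn0 leqNgt -has_count; apply/hasPn => m.
    rewrite mem_mons => /eqP md; rewrite negb_and; apply/orP; right.
    by apply/negP => /submK h; move: md; rewrite -h mdegD; lia.
  rewrite -hB (eq_count BA); congr Posz.
  rewrite -[RHS]size_filter.
  rewrite -[LHS](count_map (fun m => (m + f)%MM) A) -size_filter.
  apply/perm_size/uniq_perm.
  - rewrite filter_uniq // map_inj_uniq ?uniq_mons // => x y.
    by rewrite ![(_ + f)%MM]addmC => /addmI.
  - by rewrite filter_uniq ?uniq_mons.
  move=> m; rewrite !mem_filter mem_mons -andbA; case: (A m) => //=.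
  apply/mapP/andP => [[x]|[fm /eqP md]].
    by rewrite mem_mons => /eqP xd ->; rewrite lem_addl mdegD xd subnK.
  exists (m - f)%MM; last by rewrite submK.
  by rewrite mem_mons -(eqn_add2r (mdeg f)) -mdegD submK // md subnK.
have -> : count A (mons d) = (count (fun m => A m && ~~ (f <= m)%MM) (mons d)
   + count (fun m => A m && (f <= m)%MM) (mons d))%N.
  by elim: (mons d) => //= m s ->; case: (A m); case: (f <= m)%MM => /=; lia.
by rewrite PoszD addrK.
Qed.

(** The numerator of the Hilbert series of [R / (f)]: the generator [f k]
    removes its multiples by the monomials outside the colon ideal of the
    preceding generators, which are counted by [Q k]. *)
Lemma counted_by_iter m (f : 'I_m -> 'X_{1..n}) (Q : 'I_m -> {poly int}) :
  (forall k : 'I_m, counted_by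
     (fun x => [forall l : 'I_m, (l < k)%N ==> ~~ (f l <= x + f k)%MM])
     (Q k)) ->
  counted_by (fun x => [forall l, ~~ (f l <= x)%MM])
    (1 - \sum_k 'X^(mdeg (f k)) * Q k).
Proof.
move=> hQ.
suff step k : (k <= m)%N -> counted_by
    (fun x => [forall l : 'I_m, (l < k)%N ==> ~~ (f l <= x)%MM])
    (1 - \sum_(l < m | (l < k)%N) 'X^(mdeg (f l)) * Q l).
  have := step m (leqnn m).
  rewrite (eq_bigl xpredT) => [|l]; last exact: ltn_ord.
  by apply: counted_by_ext => x; apply: eq_forallb => l; rewrite ltn_ord.
elim: k => [_|k IH km].
  rewrite big_pred0 // subr0; apply: counted_by_ext counted_byT => x.
  by apply/esym/forallP.
rewrite (big_ord_ltS _ (Ordinal km)) opprD addrA.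
apply: counted_by_ext
  (counted_by_remove _ (IH (ltnW km)) (hQ (Ordinal km))) => //.
by move=> x; rewrite -(forall_ord_ltS (Ordinal km) (fun l => ~~ (f l <= x)%MM)).
Qed.


(** By regularity, a monomial [x] lies in the ideal of the members before
    [alpha k] as soon as [x + alpha k] does, so that removing the multiples of
    [alpha k] multiplies the numerator by [1 - t^(deg (alpha k))]. *)
Lemma counted_by_regular (K : fieldType) r (alpha : 'I_r -> 'X_{1..n}) :
  regular_sequence (fun i => 'X_[K, alpha i]) ->
  counted_by (fun x => [forall i, ~~ (alpha i <= x)%MM])
    (\prod_i (1 - 'X^(mdeg (alpha i)))).
Proof.
move=> [reg _].
suff step k : (k <= r)%N -> counted_by
    (fun x => [forall l : 'I_r, (l < k)%N ==> ~~ (alpha l <= x)%MM])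
    (\prod_(l < r | (l < k)%N) (1 - 'X^(mdeg (alpha l)))).
  have := step r (leqnn r).
  rewrite [X in counted_by _ X](eq_bigl xpredT) => [|l]; last exact: ltn_ord.
  by apply: counted_by_ext => x; apply: eq_forallb => l; rewrite ltn_ord.
elim: k => [_|k IH kr].
  rewrite big_pred0 //; apply: counted_by_ext counted_byT => x.
  by apply/esym/forallP.
have {}IH := IH (ltnW kr); pose k' := Ordinal kr.
have -> : \prod_(l < r | (l < k.+1)%N) (1 - 'X^(mdeg (alpha l)))
    = \prod_(l < r | (l < k)%N) (1 - 'X^(mdeg (alpha l)))
      - 'X^(mdeg (alpha k'))
        * \prod_(l < r | (l < k)%N) (1 - 'X^(mdeg (alpha l)))
      :> {poly int}.
  by rewrite (big_ord_ltS _ k') /= mulrBr mulr1 [X in _ - X = _]mulrC.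
apply: counted_by_ext (counted_by_remove _ IH IH) => x.
  exact/esym/(forall_ord_ltS k' (fun l => ~~ (alpha l <= x)%MM)).
apply/forallP/forallP => h l; apply/implyP => lk; last first.
  apply: contra (implyP (h l) lk) => le; apply: lepm_trans le _.
  exact: lem_addr.
apply/negP => le.
have /monomial_ideal_X/existsP[l' /andP[/= l'k le']] :
    ideal_gen (fun i => 'X_[K, alpha i]) [pred j : 'I_r | j < k]%N 'X_[x].
  apply: (reg k'); rewrite -mpolyXD; apply/monomial_ideal_X.
  by apply/existsP; exists l; rewrite /= lk addmC.
by have := implyP (h l') l'k; rewrite le'.
Qed.

Section Dimension.
Variable K : fieldType.
Local Notation R := {mpoly K[n]}.

Lemma has_dim_monomials (A : pred 'X_{1..n}) (I : R -> Prop) :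
  (forall p, I p <-> forall m, p@_m != 0 -> A m) ->
  hilbert_series I
    (fun j => if j is Posz d then count A (mons d) else 0%N).
Proof.
move=> hI [d|d].
  rewrite -size_filter; set s := [seq m <- mons d | A m].
  have us : uniq s by rewrite filter_uniq ?uniq_mons.
  have b_coef (c : 'I_(size s) -> K) m :
    (\sum_i c i *: 'X_[nth 0%MM s i] : R)@_m
      = \sum_(i < size s | nth 0%MM s i == m) c i.
    rewrite raddf_sum [RHS]big_mkcond; apply: eq_bigr => i _ /=.
    by rewrite mcoeffZ mcoeffX; case: ifP; rewrite ?mulr1 ?mulr0.
  exists (fun i => 'X_[nth 0%MM s i]); split=> [c c0 i|p].
    have := congr1 (mcoeff (nth 0%MM s i)) c0.
    rewrite b_coef mcoeff0 (big_pred1 i) // => k /=.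
    by rewrite nth_uniq //.
  split=> [[/hI pI /homog_eltP pd]|[c ->]].
    exists (fun i => p@_(nth 0%MM s i)); apply/mpolyP => m.
    rewrite b_coef; have [ms|ms] := boolP (m \in s).
      have im : (index m s < size s)%N by rewrite index_mem.
      rewrite (big_pred1 (Ordinal im)) /= ?nth_index // => k.
      by rewrite -{1}(nth_index 0%MM ms) nth_uniq.
    rewrite big1 => [|i /eqP im]; last first.
      by move: ms; rewrite -im mem_nth.
    apply/eqP; apply: contraR ms => pm.
    by rewrite mem_filter pI //= mem_mons -eqz_nat; apply/eqP/pd.
  have supp m : (\sum_i c i *: 'X_[nth 0%MM s i] : R)@_m != 0 -> m \in s.
    apply: contraR => ms; rewrite b_coef big1 // => i /eqP im.
    by move: ms; rewrite -im mem_nth.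
  split; first by apply/hI => m /supp; rewrite mem_filter => /andP[].
  apply/homog_eltP => m /supp; rewrite mem_filter mem_mons => /andP[_ /eqP ->].
  by [].
exists (fun=> 0); split=> [c _ []//|p].
split=> [[_ /= ->]|[c ->]]; first by exists (fun=> 0); rewrite big_ord0.
by rewrite big_ord0; split=> //; apply/hI => m; rewrite mcoeff0 eqxx.
Qed.

End Dimension.
End HilbertSeries.

(** * Regularity and projective dimension *)

Lemma int_max_exists (P : int -> Prop) (x B : int) :
  P x -> (forall y, P y -> y <= B) ->
  exists2 z, P z & forall y, P y -> y <= z.
Proof.
move=> Px hB; move: {2}`|B - x|%N (leqnn `|B - x|%N) => k.
elim: k x Px => [|k IH] x Px hk.
  by exists x => // y Py; have := hB y Py; have := hB x Px; lia.
have [[y [Py xy]]|no] := classic (exists y, P y /\ x < y).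
  by apply: (IH y Py); have := hB y Py; have := hB x Px; lia.
by exists x => // y Py; rewrite leNgt; apply/negP => xy; apply: no; exists y.
Qed.

Section BettiBounds.
Variables (K : fieldType) (n : nat).
Local Notation R := {mpoly K[n]}.

Lemma betti_numbers_tor_dim (I : R -> Prop) (F : graded_free_resolution I) :
  betti_numbers I (tor_dim F).
Proof. by split=> [//|G i j]; apply: tor_dim_unique. Qed.

(** [Tor_i(I, K)_j] is a subquotient of [(F_i (x) K)_j]. *)
Lemma tor_dim_neq0 (I : R -> Prop) (F : graded_free_resolution I) i j :
  tor_dim F i j <> 0%N -> exists s : 'I_(rk F i), dg s = j.
Proof.
move=> h; apply: NNPP => no; apply: h.
have P0 : tor_piece F i j = 0.
  apply/matrixP => s t; rewrite !mxE; case: (dg _ =P j) => [e|_].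
    by case: no; exists s.
  by rewrite mul0rn.
by rewrite /tor_dim /tor_cycles P0 cap0mx mxrank0.
Qed.

Section Bounds.
Variables (I : R -> Prop) (F : graded_free_resolution I).
Hypothesis I_neq0 : exists2 p, I p & p != 0.

Lemma is_reg_le (B : int) :
  (forall i (s : 'I_(rk F i)), dg s - i%:Z <= B) ->
  exists2 rho, is_reg I rho & rho <= B.
Proof.
move=> hB; have [j /eqP j0] := tor0_neq0 F I_neq0.
pose P x := exists i j, tor_dim F i j <> 0%N /\ x = j - i%:Z.
have PB y : P y -> y <= B.
  by case=> i [k [/tor_dim_neq0[s <-] ->]].
have [|rho Prho max] := @int_max_exists P (j - 0%:Z) B _ PB.
  by exists 0%N, j.
exists rho; last exact: PB.
exists (tor_dim F); split=> //; first exact: betti_numbers_tor_dim.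
by move=> i k hik; apply: max; exists i, k.
Qed.

Lemma is_pdim_le (N : nat) :
  (forall i (s : 'I_(rk F i)), (i <= N)%N) ->
  exists2 p, is_pdim I p & (p <= N)%N.
Proof.
move=> hN; have [j /eqP j0] := tor0_neq0 F I_neq0.
pose P x := exists i j, tor_dim F i j <> 0%N /\ x = i%:Z.
have PN y : P y -> y <= N%:Z.
  by case=> i [k [/tor_dim_neq0[s _] ->]]; apply: hN s.
have [|_ [p [k [pk ->]]] max] := @int_max_exists P 0%:Z N%:Z _ PN.
  by exists 0%N, j.
exists p; last by have [s _] := tor_dim_neq0 pk; apply: hN s.
exists (tor_dim F); split=> [||i l hil]; first exact: betti_numbers_tor_dim.
  by exists k.
by rewrite -lez_nat; apply: max; exists i, l.
Qed.

End Bounds.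
End BettiBounds.

(** * Ideals with regular colon ideals *)

Theorem proposition2p1 (K : fieldType) (n m : nat) (hm : (1 < m)%N)
    (f : 'I_m -> 'X_{1..n})
    (r : 'I_m -> nat) (alpha : forall k : 'I_m, 'I_(r k) -> 'X_{1..n})
    (d : 'I_m -> nat) (a : forall k : 'I_m, 'I_(r k) -> nat)
    (hmin : minimal_generators (fun k => 'X_[K, f k]))
    (hreg : forall k : 'I_m, (0 < k)%N ->
       regular_sequence (fun i => 'X_[K, alpha k i]))
    (hcolon : forall k : 'I_m, (0 < k)%N -> forall p : {mpoly K[n]},
       colon (ideal_gen (fun l => 'X_[K, f l]) [pred l : 'I_m | l < k]%N)
             'X_[K, f k] p
       <-> ideal_gen (fun i => 'X_[K, alpha k i]) xpredT p)
    (hd : forall k : 'I_m, d k = mdeg (f k))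
    (ha : forall (k : 'I_m) (i : 'I_(r k)), (0 < k)%N ->
       a k i = mdeg (alpha k i)) :
  let I : {mpoly K[n]} -> Prop :=
    ideal_gen (fun k => 'X_[K, f k]) xpredT in
  let first : 'I_m := Ordinal (ltnW hm) in
  let second : 'I_m := Ordinal hm in
  let Q : {poly int} :=
    'X^(d first)
    + \sum_(k < m | (0 < k)%N) (\prod_(i < r k) (1 - 'X^(a k i))) * 'X^(d k) in
  let bound (k : 'I_m) : int :=
    (d k)%:Z + \sum_(i < r k) (a k i)%:Z - (r k)%:Z in
  [/\ exists2 H : int -> nat, hilbert_series I H &
        forall j, (H j)%:Z
          = laurent_coef
              (series_mul (inv_one_sub_t_pow n) (series_of_poly Q)) j,
      exists2 rho : int, is_reg I rho &
        rho <= \big[Num.max/bound second]_(k < m | (0 < k)%N) bound k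
    & exists2 p : nat, is_pdim I p &
        (p <= \max_(k < m | (0 < k)%N) r k)%N].
Proof.
move=> I first second Q bound.
pose g k : {mpoly K[n]} := 'X_[K, f k].
have I_neq0 : exists2 p, I p & p != 0.
  exists (g first); first exact: (ideal_gen_in g).
  by rewrite /g -msupp_eq0 msuppX.
have a_gt0 (k : 'I_m) (i : 'I_(r k)) : (0 < k)%N -> (0 < a k i)%N.
  move=> k0; rewrite (ha k i k0) lt0n mdeg_eq0; apply/eqP => ai0.
  case: (hreg k k0) => _; apply; rewrite -(mpolyX0 n K) -ai0.
  exact: (ideal_gen_in (fun i => 'X_[K, alpha k i])).
have colon_first (p : {mpoly K[n]}) :
    p = 0 <-> colon (ideal_gen g [pred l : 'I_m | l < first]%N) (g first) p.
  rewrite /colon ideal_gen_pred0 //; split=> [->|/eqP]; first by rewrite mul0r.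
  by rewrite mulf_eq0 /g -[X in _ || X]msupp_eq0 msuppX orbF => /eqP.
have firstE (k : 'I_m) : ~~ (0 < k)%N -> k = first.
  by move=> k0; apply: val_inj => /=; lia.
have boundE k : bound k = (d k)%:Z + \sum_(i < r k) ((a k i)%:Z - 1).
  by rewrite /bound sumrB sumr_const card_ord natz addrA.
(* The colon ideal of the first generator is zero, and R alone resolves the
   quotient by it. *)
pose S (k : 'I_m) i (j : int) := if (0 < k)%N
  then (i <= r k)%N /\ j - i%:Z <= \sum_(i < r k) ((a k i)%:Z - 1)
  else i = 0%N /\ j = 0.
have colon_resolved k :
    resolved_within (S k) (colon (ideal_gen g [pred l : 'I_m | l < k]%N) (g k)).
  rewrite /S; case: (boolP (0 < k)%N) => [k0|/firstE ->]; last first.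
    exact: resolved_within_ext colon_first (resolved_within0 K n).
  apply: resolved_within_ext; first by move=> p; apply: iff_sym; apply: hcolon.
  apply: resolved_within_koszul (hreg k k0) => i; last exact: a_gt0.
  by rewrite ha //; apply: homog_eltX.
have hg (k : 'I_m) : homog_elt (d k)%:Z (g k) by rewrite hd; apply: homog_eltX.
have [F hF] := resolved_within_iter hg colon_resolved.
have hF' i (s : 'I_(rk F i)) : exists k, S k i (dg s - (d k)%:Z) := hF i.+1 s.
have d_first : (d first)%:Z <= bound second.
  have colonE := monomial_colonE (hcolon second isT).
  (* The monomial f_1 / gcd(f_1, f_2) shows that the colon ideal is nonzero. *)
  have [i _] : exists i : 'I_(r second), true.
    have /existsP[i _] :
        [exists i, (alpha second i <= f first - f second)%MM].
      rewrite -colonE; apply/existsP; exists first; apply/mnm_lepP => i.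
      by rewrite mnmDE mnmBE; lia.
    by exists i.
  have : [exists i', (alpha second i' <= alpha second i)%MM].
    by apply/existsP; exists i; apply: lepm_refl.
  rewrite -colonE => /existsP[l /andP[l_lt1]].
  have -> : l = first by apply: val_inj => /=; move: l_lt1 => /=; lia.
  have f21 := minimal_generators_nmid hmin (isT : second != first).
  move=> /mdeg_lt_colon/(_ f21).
  rewrite -!hd -ha // boundE (bigD1 i) //=.
  have : 0 <= \sum_(k < r second | k != i) ((a second k)%:Z - 1).
    by apply: sumr_ge0 => k _; have := a_gt0 second k isT; lia.
  by move: (\sum_(_ < _ | _) _) => T T0; lia.
split.
- pose QS (k : 'I_m) : {poly int} :=
    if (0 < k)%N then \prod_(i < r k) (1 - 'X^(a k i)) else 1.
  have hQS (k : 'I_m) : counted_by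
     (fun x => [forall l : 'I_m, (l < k)%N ==> ~~ (f l <= x + f k)%MM]) (QS k).
    rewrite /QS; case: (boolP (0 < k)%N) => [k0|/firstE ->]; last first.
      by apply: counted_by_ext (counted_byT n) => x; apply/esym/forallP.
    under eq_bigr do rewrite (ha _ _ k0).
    apply: counted_by_ext (counted_by_regular (hreg k k0)) => x.
    apply: negb_inj; rewrite !negb_forall.
    under eq_existsb do rewrite negbK.
    under [RHS]eq_existsb do rewrite negb_imply negbK.
    exact/esym/(monomial_colonE (hcolon k k0)).
  pose A x := [exists l : 'I_m, (f l <= x)%MM].
  have hA : counted_by A Q.
    have -> : Q = 1 - (1 - \sum_k 'X^(mdeg (f k)) * QS k).
      rewrite opprB addrC subrK (bigD1 first) //= -hd mulr1.
      congr (_ + _); apply: eq_big => [k|k k0].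
        by rewrite lt0n; apply/idP/idP; apply: contra => /eqP ?; apply/eqP;
          [subst | apply: val_inj].
      by rewrite /QS k0 mulrC hd.
    apply: counted_by_ext (counted_byC (counted_by_iter hQS)) => x /=.
    by rewrite negb_forall; apply: eq_existsb => l; rewrite negbK.
  exists (fun j => if j is Posz e then count A (mons n e) else 0%N).
    apply: has_dim_monomials => p; exact: monomial_idealP.
  by case=> e //=; rewrite hA.
- apply: (is_reg_le (F := F) I_neq0) => i s.
  have [k] := hF' i s; rewrite /S; case: (boolP (0 < k)%N) => [k0 [_ hk]|].
    apply: (@le_trans _ _ (bound k)); first by rewrite boundE; lia.
    exact: le_bigmax_cond.
  move=> /firstE -> [i0]; move: s; rewrite {}i0 => s /eqP.
  rewrite subr_eq0 => /eqP ->.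
  by rewrite subr0 (le_trans d_first) // bigmax_ge_id.
- apply: (is_pdim_le (F := F) I_neq0) => i s.
  have [k] := hF' i s; rewrite /S; case: (boolP (0 < k)%N) => [k0 [hk _]|].
    by apply: leq_trans hk _; apply: (leq_bigmax_cond k k0).
  by move=> _ [i0 _]; rewrite i0.
Qed.
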